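(* Suppose $(U,S)$ is a weak action pair in a monoid, with $U$ and $S$ both submonoids of that monoid. Let $$M=\{(u,s)\in U\rtimes S:u=us^+\},$$ which is a subsemigroup of $U\rtimes S$ and a monoid with identity $(1,1)$, let $\vartheta=\{((u,s),(v,t))\in M\times M:us=vt\}$ (the kernel of the surjective morphism $M\to US:(u,s)\mapsto us$), and suppose that $\vartheta=\Omega^\sharp$ is the congruence on $M$ generated by a set of pairs $\Omega\subseteq M\times M$. Then, with the notation of the context, the monoid $US$ has presentation $$\operatorname{Mon}\langle X_U\cup X_S:R_U\cup R_S\cup R_1\cup R_3\cup R_\Omega\rangle$$ via the morphism $\Phi:(X_U\cup X_S)^*\to US$ determined by $x\mapsto x\phi_U$ for $x\in X_U$ and $x\mapsto x\phi_S$ for $x\in X_S$, where $$R_1=\{(xy,\,{}^xy\cdot x):x\in X_S,\ y\in X_U\},\qquad R_3=\{(x,\,x^+x):x\in X_S,\ \overline x^+\neq1\},$$ $$R_\Omega=\{(N(\mathbf a),N(\mathbf b)):(\mathbf a,\mathbf b)\in\Omega\},$$ with ${}^xy=N_U({}^{\overline x}\,\overline y)\in X_U^*$ and $x^+=N_U(\overline x^+)\in X_U^*$ for $x\in X_S$, $y\in X_U$, and $N(u,s)=N_U(u)N_S(s)$ for $(u,s)\in M$.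
   Context: Weak action pairs. For a monoid with identity $1$ and a subsemigroup $U$ of it, $U^1=U\cup\{1\}$. A weak action pair in the monoid is a pair $(U,S)$ of subsemigroups with a left action $(s,u)\mapsto{}^su$ of $S$ on $U^1$ by semigroup morphisms (${}^s({}^tu)={}^{st}u$ and ${}^s(uv)={}^su\cdot{}^sv$) such that $s\cdot u={}^su\cdot s$ for all $s\in S$, $u\in U^1$. Write $s^+={}^s1$ for $s\in S$. $US=\{us:u\in U,s\in S\}$. $U\rtimes S$ is the set $U\times S$ with product $(u,s)(v,t)=(u\cdot{}^sv,st)$. Presentations. $X^*$ is the free monoid on $X$, with empty word $\iota$; for $R\subseteq X^*\times X^*$, $R^\sharp$ is the congruence generated by $R$. A monoid $T$ has presentation $\operatorname{Mon}\langle X:R\rangle$ via $\phi$ if $\phi:X^*\to T$ is a surjective monoid morphism with kernel $R^\sharp$. A normal form function is a map $N:T\to X^*$ with $N(t)\phi=t$ for all $t\in T$. Maps are written on the right. Fixed data. $U$ has presentation $\operatorname{Mon}\langle X_U:R_U\rangle$ via $\phi_U:X_U^*\to U$, and $S$ has presentation $\operatorname{Mon}\langle X_S:R_S\rangle$ via $\phi_S:X_S^*\to S$, where $X_U\cap X_S=\varnothing$, no letter of $X_U$ or $X_S$ maps to $1$, and $\phi_U|_{X_U}$, $\phi_S|_{X_S}$ are injective. Write $\overline w=w\phi_U$ for $w\in X_U^*$ and $\overline w=w\phi_S$ for $w\in X_S^*$. $N_U:U\to X_U^*$ and $N_S:S\to X_S^*$ are fixed normal form functions with $N_U(1)=N_S(1)=\iota$,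 $N_U(\overline x)=x$ for $x\in X_U$, and $N_S(\overline y)=y$ for $y\in X_S$. *)

(* Defs.v *)
From HB Require Import structures.
From mathcomp Require Import all_boot.
From mathcomp Require Import boolp classical_sets.

Set Implicit Arguments.
Unset Strict Implicit.
Unset Printing Implicit Defensive.

Local Open Scope classical_set_scope.
Local Open Scope group_scope.

(* Subsemigroups, submonoids and the monoids U, S, M, US are subsets of an
   ambient monoid (or magma), and a congruence on such a subset A is a set of
   pairs contained in A `*` A. *)

Definition subsemigroup (T : magmaType) (A : set T) : Prop :=
  forall a b, A a -> A b -> A (a * b).

Definition submonoid (T : baseUMagmaType) (A : set T) : Prop :=
  A 1 /\ subsemigroup A.

Record congruence (T : magmaType) (A : set T) (r : set (T * T)) : Prop :=
  Congruence {
    congruence_sub : r `<=` A `*` A;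
    congruence_refl : forall a, A a -> r (a, a);
    congruence_sym : forall a b, r (a, b) -> r (b, a);
    congruence_trans : forall a b c, r (a, b) -> r (b, c) -> r (a, c);
    congruence_mull : forall a b c, A c -> r (a, b) -> r (c * a, c * b);
    congruence_mulr : forall a b c, A c -> r (a, b) -> r (a * c, b * c) }.

(* For A closed under the product and W contained in A `*` A, the relation
   A `*` A is itself a congruence containing W, so this is the usual
   intersection of a nonempty family. *)
Definition generated_congruence (T : magmaType) (A : set T)
    (W : set (T * T)) : set (T * T) :=
  smallest (@congruence T A) W.

Definition free_monoid (X : Type) : Type := seq X.

HB.instance Definition _ (X : Type) := hasMul.Build (free_monoid X) (@cat X).
HB.instance Definition _ (X : Type) := hasOne.Build (free_monoid X) [::].

Definition letter (X : Type) (x : X) : free_monoid X := [:: x].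

Definition word_map (X Y : Type) (f : X -> Y) (w : free_monoid X) :
  free_monoid Y := map f w.

Definition free_ext (G : monoidType) (X : Type) (f : X -> G)
    (w : free_monoid X) : G :=
  \big[*%g/1]_(x <- (w : seq X)) f x.

(* The submonoid T of G has presentation Mon< X : R > via phi.  The morphism
   phi : X^* -> T is given as a morphism into G with image T. *)
Definition has_presentation (G : monoidType) (T : set G) (X : Type)
    (R : set (free_monoid X * free_monoid X)) (phi : free_monoid X -> G) :
    Prop :=
  [/\ monoid_morphism phi,
      range phi = T
    & [set p | phi p.1 = phi p.2] = generated_congruence [set: free_monoid X] R].

(* Only the values of N on T are relevant. *)
Definition normal_form_function (G : monoidType) (T : set G) (X : Type)
    (phi : free_monoid X -> G) (N : G -> free_monoid X) : Prop :=
  forall t, T t -> phi (N t) = t.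

Definition adjoin1 (T : baseUMagmaType) (A : set T) : set T := A `|` [set 1].

(* act s u stands for ^s u; only its values for s in S and u in U^1 are
   relevant. *)
Record weak_action_pair (G : monoidType) (U S : set G) (act : G -> G -> G) :
    Prop := WeakActionPair {
  wap_subsemigroupl : subsemigroup U;
  wap_subsemigroupr : subsemigroup S;
  wap_act_stable : forall s u, S s -> adjoin1 U u -> adjoin1 U (act s u);
  wap_actM : forall s t u, S s -> S t -> adjoin1 U u ->
    act s (act t u) = act (s * t) u;
  wap_act_morph : forall s u v, S s -> adjoin1 U u -> adjoin1 U v ->
    act s (u * v) = act s u * act s v;
  wap_commute : forall s u, S s -> adjoin1 U u -> s * u = act s u * s }.

Definition set_mul (G : magmaType) (U S : set G) : set G :=
  [set u * s | u in U & s in S].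

(* The product set G * G with the semidirect multiplication determined by act
   (the library's product on G * G being the componentwise one). *)
Definition semidirect (G : magmaType) (act : G -> G -> G) : Type :=
  (G * G)%type.

HB.instance Definition _ (G : magmaType) (act : G -> G -> G) :=
  hasMul.Build (semidirect act)
    (fun a b => (a.1 * act a.2 b.1, a.2 * b.2)).

HB.instance Definition _ (G : baseUMagmaType) (act : G -> G -> G) :=
  hasOne.Build (semidirect act) (1, 1).

Section Semidirect.
Variables (G : monoidType) (U S : set G) (act : G -> G -> G).

Definition semidirect_set : set (semidirect act) := [set a | U a.1 /\ S a.2].

Definition Mset : set (semidirect act) :=
  [set a | semidirect_set a /\ a.1 = a.1 * act a.2 1].

Definition theta : set (semidirect act * semidirect act) :=
  [set p | [/\ Mset p.1, Mset p.2 & p.1.1 * p.1.2 = p.2.1 * p.2.2]].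

Hypotheses (wap : weak_action_pair U S act) (U1 : U 1) (S1 : S 1).

Let adjoin1E u : U u -> adjoin1 U u. Proof. by left. Qed.

Let act_stable s u : S s -> U u -> U (act s u).
Proof.
by move=> Ss Uu; case: (wap_act_stable wap Ss (adjoin1E Uu)) => [|->].
Qed.

Let act1 u : U u -> act 1 u = u.
Proof.
by move=> Uu; move: (wap_commute wap S1 (adjoin1E Uu)); rewrite mul1g mulg1.
Qed.

Lemma semidirect_set_subsemigroup : subsemigroup semidirect_set.
Proof.
move=> a b [Ua Sa] [Ub Sb]; split.
- by apply: (wap_subsemigroupl wap) => //; apply: act_stable.
- exact: (wap_subsemigroupr wap).
Qed.

Lemma semidirect_mulA (a b c : semidirect act) :
  semidirect_set a -> semidirect_set b -> semidirect_set c ->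
  a * (b * c) = a * b * c.
Proof.
case: a b c => [u s] [v t] [w r] [/= Uu Ss] [/= Uv St] [/= Uw Sr].
congr pair; last exact: mulgA.
rewrite /= (wap_act_morph wap) ?(wap_actM wap) ?mulgA//.
all: by apply: adjoin1E => //; apply: act_stable.
Qed.

Lemma Mset_submonoid : submonoid Mset.
Proof.
split; first by split=> //=; rewrite act1// mulg1.
move=> a b [ab_a Ea] [ab_b Eb]; split; first exact: semidirect_set_subsemigroup.
case: ab_a ab_b => Ua Sa [Ub Sb].
have /= := Eb; case: a b Ua Sa Ub Sb {Ea Eb} => u s [v t] /= Uu Ss Uv St Ev.
rewrite {1}Ev (wap_act_morph wap) ?(wap_actM wap) ?mulgA//.
all: by apply: adjoin1E => //; apply: act_stable.
Qed.

Lemma Mset_mul1 a : Mset a -> 1 * a = a /\ a * 1 = a.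
Proof.
case: a => u s [[/= Uu Ss] E]; split; congr pair; rewrite /= ?mul1g ?mulg1 //.
exact: act1.
Qed.

Lemma Mset_mul_morph (a b : semidirect act) : Mset a -> Mset b ->
  (a * b).1 * (a * b).2 = (a.1 * a.2) * (b.1 * b.2).
Proof.
case: a b => [u s] [v t] [[/= Uu Ss] _] [[/= Uv St] _].
have E := wap_commute wap Ss (adjoin1E Uv).
by rewrite mulgA -(mulgA u _ s) -E !mulgA.
Qed.

Lemma Mset_mul_surj :
  [set a.1 * a.2 | a in Mset] = set_mul U S.
Proof.
apply/seteqP; split=> [_ [a [[Ua Sa] _] <-]|_ [u Uu [s Ss <-]]].
  by exists a.1 => //; exists a.2.
have E1 := wap_act_morph wap Ss (adjoin1E U1) (adjoin1E U1).
rewrite mulg1 in E1.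
have Es := wap_commute wap Ss (adjoin1E U1); rewrite mulg1 in Es.
exists (u * act s 1, s); last by rewrite /= -mulgA -Es.
split; last by rewrite /= -mulgA -E1.
by split=> //=; apply: (wap_subsemigroupl wap) => //; apply: act_stable.
Qed.

End Semidirect.

Arguments semidirect_set {G} U S act.
Arguments Mset {G} U S act.
Arguments theta {G} U S act.

Section Relations.
Variables (G : monoidType) (XU XS : Type) (act : G -> G -> G).
Variables (phiU : free_monoid XU -> G) (phiS : free_monoid XS -> G).
Variables (NU : G -> free_monoid XU) (NS : G -> free_monoid XS).

(* Words over the disjoint union of the two alphabets. *)
Local Notation word := (free_monoid (XU + XS)).

Definition wordU : free_monoid XU -> word := word_map inl.
Definition wordS : free_monoid XS -> word := word_map inr.

Definition letter_value (z : XU + XS) : G :=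
  match z with
  | inl x => phiU (letter x)
  | inr x => phiS (letter x)
  end.

Definition Phi : word -> G := free_ext letter_value.

Definition lift_relU (RU : set (free_monoid XU * free_monoid XU)) :
    set (word * word) :=
  [set (wordU p.1, wordU p.2) | p in RU].

Definition lift_relS (RS : set (free_monoid XS * free_monoid XS)) :
    set (word * word) :=
  [set (wordS p.1, wordS p.2) | p in RS].

Definition word_act (x : XS) (y : XU) : free_monoid XU :=
  NU (act (phiS (letter x)) (phiU (letter y))).

Definition word_plus (x : XS) : free_monoid XU := NU (act (phiS (letter x)) 1).

Definition rel1 : set (word * word) :=
  [set (wordS (letter x) * wordU (letter y),
        wordU (word_act x y) * wordS (letter x)) | x in [set: XS] & y in [set: XU]].

Definition rel3 : set (word * word) :=
  [set (wordS (letter x), wordU (word_plus x) * wordS (letter x)) |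
    x in [set x : XS | act (phiS (letter x)) 1 <> 1]].

Definition normal_word (a : semidirect act) : word :=
  wordU (NU a.1) * wordS (NS a.2).

Definition relOmega (Omega : set (semidirect act * semidirect act)) :
    set (word * word) :=
  [set (normal_word p.1, normal_word p.2) | p in Omega].

End Relations.

(* Main.v *)
Require Import Defs.
From mathcomp Require Import all_boot.
From mathcomp Require Import boolp classical_sets.

(** The relations are valid in US: those of R_1 say s u = (^s u) s, those of
    R_3 say s = s 1 = (^s 1) s = s^+ s, and Omega is contained in the kernel
    theta of the map M -> US.  So the kernel of Phi contains the congruence ~
    generated by the relations, and the work lies in the converse.

    With R_1, R_3 and the relations of U, a word over X_S can be moved to the
    right across a word over X_U: w v ~ N_U(^w v) w ([wordS_wordU]).  The
    relations R_3 are what makes this hold for the empty v as well, where it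
    reads x ~ x^+ x.  Consequently
    - the normal words multiply as in the semidirect product,
      N(a) N(b) ~ N(a b) ([normal_wordM]);
    - every word is equivalent to N(a) for some a in M ([reduce_to_normal]):
      a letter x of X_S is x^+ x ~ N(x^+, x), which is the normal word of an
      element of M, and multiplying a normal word by a letter on the left
      gives a normal word again.

    By the first point the pairs (a, b) of M * M with N(a) ~ N(b) form a
    congruence on M.  It contains Omega because of the relations R_Omega,
    hence contains theta: if a and b have the same product in US then
    N(a) ~ N(b) ([normal_word_theta]).  If now Phi v = Phi w, then v ~ N(a)
    and w ~ N(b) with a and b in M, and (a, b) lies in theta since ~ is
    contained in the kernel of Phi; so v ~ N(a) ~ N(b) ~ w. *)

Local Open Scope classical_set_scope.
Local Open Scope group_scope.

(** * Congruences *)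

Section Congruences.
Context {T : magmaType}.
Implicit Types (W r : set (T * T)) (a b c d : T).

Lemma generated_congruence_full W :
  congruence [set: T] (generated_congruence [set: T] W).
Proof.
split; first by [].
- by move=> a Ta r [cr _]; apply: (congruence_refl cr).
- by move=> a b Wab r Hr; apply: (congruence_sym Hr.1); apply: Wab.
- move=> a b c Wab Wbc r Hr.
  by apply: (congruence_trans Hr.1) (Wab _ Hr) (Wbc _ Hr).
- by move=> a b c Tc Wab r Hr; apply: (congruence_mull Hr.1) => //; apply: Wab.
- by move=> a b c Tc Wab r Hr; apply: (congruence_mulr Hr.1) => //; apply: Wab.
Qed.

Lemma generated_congruence_min {A : set T} {W r} :
  congruence A r -> W `<=` r -> generated_congruence A W `<=` r.
Proof. exact: smallest_sub. Qed.

Lemma congruence_mul {r} (cr : congruence [set: T] r) {a b c d} :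
  r (a, b) -> r (c, d) -> r (a * c, b * d).
Proof.
move=> rab rcd; apply: (congruence_trans cr (b := b * c)).
  by apply: (congruence_mulr cr).
by apply: (congruence_mull cr).
Qed.

Lemma congruence_diag : congruence [set: T] [set p | p.1 = p.2].
Proof. by split=> //= [a b c -> ->|a b c _ ->|a b c _ ->]. Qed.

End Congruences.

(** The map f is only asked to be a morphism modulo r: this is the case of the
    normal words on M. *)
Lemma congruence_preimage {T T' : magmaType} {A : set T} {f : T -> T'}
    {r : set (T' * T')} :
    subsemigroup A -> congruence [set: T'] r ->
    (forall a b, A a -> A b -> r (f (a * b), f a * f b)) ->
  congruence A [set p | [/\ A p.1, A p.2 & r (f p.1, f p.2)]].
Proof.
move=> mulA cr fM; split=> /=.
- by move=> p [].
- by move=> a Aa; split=> //; apply: (congruence_refl cr).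
- by move=> a b [Aa Ab rab]; split=> //; apply: (congruence_sym cr).
- move=> a b c [Aa _ rab] [_ Ac rbc]; split=> //.
  exact: (congruence_trans cr) rbc.
- move=> a b c Ac [Aa Ab rab]; split; try exact: mulA.
  apply: (congruence_trans cr) (fM _ _ Ac Aa) _.
  apply: (congruence_trans cr (b := f c * f b)).
    by apply: (congruence_mull cr).
  by apply: (congruence_sym cr); apply: fM.
- move=> a b c Ac [Aa Ab rab]; split; try exact: mulA.
  apply: (congruence_trans cr) (fM _ _ Aa Ac) _.
  apply: (congruence_trans cr (b := f b * f c)).
    by apply: (congruence_mulr cr).
  by apply: (congruence_sym cr); apply: fM.
Qed.

Lemma congruence_kernel {T T' : magmaType} {f : T -> T'} :
  {morph f : a b / a * b} -> congruence [set: T] [set p | f p.1 = f p.2].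
Proof.
move=> fM.
have -> : [set p | f p.1 = f p.2] =
    [set p | [/\ [set: T] p.1, [set: T] p.2 & f p.1 = f p.2]].
  by apply/seteqP; split=> p //= [].
by apply: congruence_preimage congruence_diag _ => // a b _ _; apply: fM.
Qed.

(** * Words *)

Lemma free_mulA {X : Type} (u v w : free_monoid X) : u * (v * w) = u * v * w.
Proof. exact: catA. Qed.

Lemma free_mul1 {X : Type} (u : free_monoid X) : u * 1 = u.
Proof. exact: cats0. Qed.

Lemma free_cons {X : Type} (x : X) (w : free_monoid X) :
  (x :: w : free_monoid X) = letter x * w.
Proof. by []. Qed.

Lemma word_mapM {X Y : Type} (f : X -> Y) :
  {morph word_map f : v w / v * w}.
Proof. by move=> v w; apply: map_cat. Qed.

Lemma free_extM {G : monoidType} {X : Type} (f : X -> G) :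
  {morph free_ext f : v w / v * w}.
Proof. by move=> v w; apply: big_cat. Qed.

Lemma free_ext1 {G : monoidType} {X : Type} (f : X -> G) : free_ext f 1 = 1.
Proof. exact: big_nil. Qed.

Lemma free_ext_letter {G : monoidType} {X : Type} (f : X -> G) x :
  free_ext f (letter x) = f x.
Proof. exact: big_seq1. Qed.

(** The preimage of r under f is a congruence, so it contains the congruence
    generated by R, which is the kernel of phi.  This carries the relations of
    U and of S over to words on the union of the two alphabets. *)
Lemma presentation_transfer {G : monoidType} {T : set G} {X Y : Type}
    {R : set (free_monoid X * free_monoid X)} {phi : free_monoid X -> G}
    {f : free_monoid X -> free_monoid Y}
    {r : set (free_monoid Y * free_monoid Y)} :
    has_presentation T R phi -> congruence [set: free_monoid Y] r ->
    {morph f : v w / v * w} -> (forall p, R p -> r (f p.1, f p.2)) ->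
  forall v w, phi v = phi w -> r (f v, f w).
Proof.
move=> [_ _ kerE] cr fM Rr v w Evw.
have: generated_congruence [set: free_monoid X] R (v, w) by rewrite -kerE.
have subT : subsemigroup [set: free_monoid X] by [].
have cpre := congruence_preimage (A := setT) (f := f) subT cr.
case/(generated_congruence_min (cpre _)) => //.
  by move=> a b _ _; rewrite fM; apply: (congruence_refl cr).
by move=> p Rp; split=> //; apply: Rr.
Qed.

(** * Rewriting words to normal words *)

Section NormalWords.
Context {G : monoidType} {U S : set G} {act : G -> G -> G} {XU XS : Type}.
Context {RU : set (free_monoid XU * free_monoid XU)}.
Context {RS : set (free_monoid XS * free_monoid XS)}.
Context {phiU : free_monoid XU -> G} {phiS : free_monoid XS -> G}.
Context {NU : G -> free_monoid XU} {NS : G -> free_monoid XS}.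
Context {Omega : set (semidirect act * semidirect act)}.
Hypotheses (hUS : weak_action_pair U S act).
Hypotheses (hU : submonoid U) (hS : submonoid S).
Hypotheses (hphiU : has_presentation U RU phiU).
Hypotheses (hphiS : has_presentation S RS phiS).
Hypotheses (hNU : normal_form_function U phiU NU).
Hypotheses (hNS : normal_form_function S phiS NS).
Hypothesis NU_1 : NU 1 = 1.

Local Notation word := (free_monoid (XU + XS)).
Local Notation wU := (@wordU XU XS).
Local Notation wS := (@wordS XU XS).
Local Notation relations :=
  (lift_relU RU `|` lift_relS RS `|` rel1 act phiU phiS NU
   `|` rel3 act phiS NU `|` relOmega NU NS Omega).
Local Notation r := (generated_congruence [set: word] relations).
Local Notation "v ~ w" := (r (v, w)) (at level 70).

Let cr : congruence [set: word] r := generated_congruence_full relations.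

Let eqvR (v : word) : v ~ v.
Proof. exact: (congruence_refl cr). Qed.

Let eqvT {u v w : word} : u ~ v -> v ~ w -> u ~ w.
Proof. exact: (congruence_trans cr). Qed.

Let eqvS {v w : word} : v ~ w -> w ~ v.
Proof. exact: (congruence_sym cr). Qed.

Let eqvMl (u : word) {v w : word} : v ~ w -> u * v ~ u * w.
Proof. exact: (congruence_mull cr). Qed.

Let eqvMr (u : word) {v w : word} : v ~ w -> v * u ~ w * u.
Proof. exact: (congruence_mulr cr). Qed.

Let eqv_rel p : relations p -> r p.
Proof. exact: sub_gen_smallest. Qed.

Let phiUM : {morph phiU : v w / v * w}.
Proof. by case: hphiU => -[]. Qed.

Let phiSM : {morph phiS : v w / v * w}.
Proof. by case: hphiS => -[]. Qed.

Let phiU1 : phiU 1 = 1.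
Proof. by case: hphiU => -[]. Qed.

Let phiS1 : phiS 1 = 1.
Proof. by case: hphiS => -[]. Qed.

Let U_phiU w : U (phiU w).
Proof. by case: hphiU => _ <- _; exists w. Qed.

Let S_phiS w : S (phiS w).
Proof. by case: hphiS => _ <- _; exists w. Qed.

Let SM {s t} : S s -> S t -> S (s * t). Proof. exact: hS.2. Qed.

Let U_act {s u} : S s -> U u -> U (act s u).
Proof.
move=> Ss Uu; case: (wap_act_stable hUS Ss (or_introl Uu)) => // ->.
exact: hU.1.
Qed.

Let act_morph {s u v} : S s -> U u -> U v -> act s (u * v) = act s u * act s v.
Proof. by move=> Ss Uu Uv; apply: (wap_act_morph hUS) => //; left. Qed.

Let actM {s t u} : S s -> S t -> U u -> act s (act t u) = act (s * t) u.
Proof. by move=> Ss St Uu; apply: (wap_actM hUS) => //; left. Qed.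

Let act_commute {s u} : S s -> U u -> s * u = act s u * s.
Proof. by move=> Ss Uu; apply: (wap_commute hUS) => //; left. Qed.

Let act1 {u} : U u -> act 1 u = u.
Proof. by move=> Uu; have := act_commute hS.1 Uu; rewrite mul1g mulg1. Qed.

Let wUM : {morph wU : v w / v * w}. Proof. exact: word_mapM. Qed.
Let wSM : {morph wS : v w / v * w}. Proof. exact: word_mapM. Qed.

Lemma wordU_eqv v w : phiU v = phiU w -> wU v ~ wU w.
Proof.
apply: (presentation_transfer hphiU cr) => // p Rp.
by apply: eqv_rel; do 4 left; exists p.
Qed.

Lemma wordS_eqv v w : phiS v = phiS w -> wS v ~ wS w.
Proof.
apply: (presentation_transfer hphiS cr) => // p Rp.
by apply: eqv_rel; do 3 left; right; exists p.
Qed.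

Let NU_eqv {u w} : phiU w = u -> wU w ~ wU (NU u).
Proof. by move=> <-; apply: wordU_eqv; rewrite hNU. Qed.

Let NU_eqvM {u v} : U u -> U v -> wU (NU u) * wU (NU v) ~ wU (NU (u * v)).
Proof. by move=> Uu Uv; rewrite -wUM; apply: NU_eqv; rewrite phiUM !hNU. Qed.

Let NS_eqvM {s t} : S s -> S t -> wS (NS s) * wS (NS t) ~ wS (NS (s * t)).
Proof.
move=> Ss St; rewrite -wSM; apply: wordS_eqv.
by rewrite phiSM !hNS //; apply: SM.
Qed.

(** R_3 has no pair for x when x^+ = 1, but then the word N_U(x^+) is empty. *)
Lemma letterS_plus x :
  wS (letter x) ~ wU (NU (act (phiS (letter x)) 1)) * wS (letter x).
Proof.
have [E|N1] := pselect (act (phiS (letter x)) 1 = 1).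
  by rewrite E NU_1; apply: eqvR.
by apply: eqv_rel; left; right; exists x.
Qed.

(** Induction on v: R_1 moves x across one letter at a time, and the empty word
    at the end of v contributes x^+ by R_3, in accordance with
    ^x v = ^x v x^+. *)
Lemma letterS_wordU x v :
  wS (letter x) * wU v ~ wU (NU (act (phiS (letter x)) (phiU v))) * wS (letter x).
Proof.
set s := phiS (letter x); have Ss : S s by apply: S_phiS.
elim: v => [|y v IHv].
  by rewrite (phiU1 : phiU [::] = 1) [_ * _]free_mul1; apply: letterS_plus.
rewrite free_cons wUM phiUM act_morph //.
have step : wS (letter x) * wU (letter y) ~
    wU (NU (act s (phiU (letter y)))) * wS (letter x).
  by apply: eqv_rel; do 2 left; right; exists x => //; exists y.
apply: eqvT; first by rewrite free_mulA; apply: eqvMr step.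
apply: eqvT; first by rewrite -free_mulA; apply: eqvMl IHv.
by rewrite free_mulA; apply: eqvMr; apply: NU_eqvM; apply: U_act.
Qed.

Lemma wordS_wordU w v :
  wS w * wU v ~ wU (NU (act (phiS w) (phiU v))) * wS w.
Proof.
elim: w v => [|x w IHw] v.
  by rewrite (phiS1 : phiS [::] = 1) act1 // [_ * wS _]free_mul1; apply: NU_eqv.
rewrite free_cons wSM phiSM -actM //.
apply: eqvT; first by rewrite -free_mulA; apply: eqvMl (IHw v).
apply: eqvT; first by rewrite free_mulA; apply: eqvMr (letterS_wordU x _).
by rewrite hNU -?free_mulA //; apply: U_act.
Qed.

Lemma normal_wordM (a b : semidirect act) :
    semidirect_set U S act a -> semidirect_set U S act b ->
  normal_word NU NS a * normal_word NU NS b ~ normal_word NU NS (a * b).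
Proof.
case: a b => [u s] [v t] [/= Uu Ss] [/= Uv St]; rewrite /normal_word /=.
have move_s : wS (NS s) * wU (NU v) ~ wU (NU (act s v)) * wS (NS s).
  by have := wordS_wordU (NS s) (NU v); rewrite hNS // hNU.
have Usv : U (act s v) by apply: U_act.
rewrite -free_mulA [wS (NS s) * (_ * _)]free_mulA.
apply: eqvT; first by apply: eqvMl; apply: eqvMr move_s.
rewrite -!free_mulA free_mulA.
by apply: (congruence_mul cr); [apply: NU_eqvM | apply: NS_eqvM].
Qed.

(** The set of pairs (a, b) of M * M with N(a) ~ N(b) is a congruence since N is
    multiplicative modulo ~; being generated by Omega, theta lies in it. *)
Lemma normal_word_theta {a b : semidirect act} :
    theta U S act = generated_congruence (Mset U S act) Omega ->
    Omega `<=` Mset U S act `*` Mset U S act ->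
  theta U S act (a, b) -> normal_word NU NS a ~ normal_word NU NS b.
Proof.
move=> -> Omega_sub.
have [_ mulM] := Mset_submonoid hUS hU.1 hS.1.
have cpre := congruence_preimage (f := normal_word NU NS) mulM cr.
case/(generated_congruence_min (cpre _)) => //.
  by move=> c d [Mc _] [Md _]; apply: eqvS; apply: normal_wordM.
move=> p Op; have [Mp1 Mp2] := Omega_sub _ Op.
by split=> //; apply: eqv_rel; right; exists p.
Qed.

(** The pair (1, x) need not lie in M when x is a letter of X_S, which is why x
    is first replaced by x^+ x: the pair (x^+, x) satisfies x^+ = x^+ x^+. *)
Lemma reduce_letter z :
  exists2 a, Mset U S act a & letter z ~ normal_word NU NS a.
Proof.
case: z => [y|x].
  exists (phiU (letter y), 1); last first.
    rewrite -[letter _](@free_mul1 (XU + XS)).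
    apply: (congruence_mul cr); first exact: (NU_eqv (w := letter y)).
    by apply: (wordS_eqv 1); rewrite hNS //; apply: hS.1.
  split; first by split; [apply: U_phiU | apply: hS.1].
  by rewrite /= act1 ?mulg1 //; apply: hU.1.
set s := phiS (letter x); have Ss : S s by apply: S_phiS.
exists (act s 1, s); last first.
  apply: eqvT (letterS_plus x) _; apply: eqvMl; apply: wordS_eqv.
  by rewrite hNS.
have U1 : U 1 by apply: hU.1.
split; first by split=> //; apply: U_act.
by rewrite /= -act_morph // mulg1.
Qed.

Lemma reduce_to_normal w :
  exists2 a, Mset U S act a & w ~ normal_word NU NS a.
Proof.
have [M1 MM] := Mset_submonoid hUS hU.1 hS.1.
elim: w => [|z w [b Mb wb]].
  exists 1 => //.
  apply: (congruence_mul cr (a := 1) (c := 1)).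
    by rewrite NU_1; apply: eqvR.
  by apply: (wordS_eqv 1); rewrite hNS //; apply: hS.1.
have [a Ma za] := reduce_letter z.
exists (a * b); first exact: MM.
apply: eqvT (congruence_mul cr za wb) _.
by apply: normal_wordM; [case: Ma | case: Mb].
Qed.

(** * The relations hold in US *)

Lemma Phi_wordU w : Phi phiU phiS (wU w) = phiU w.
Proof.
elim: w => [|y w IHw]; first by rewrite [LHS]free_ext1 -phiU1.
rewrite free_cons wUM [LHS]free_extM phiUM -IHw.
by rewrite [free_ext _ _ in LHS]free_ext_letter.
Qed.

Lemma Phi_wordS w : Phi phiU phiS (wS w) = phiS w.
Proof.
elim: w => [|x w IHw]; first by rewrite [LHS]free_ext1 -phiS1.
rewrite free_cons wSM [LHS]free_extM phiSM -IHw.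
by rewrite [free_ext _ _ in LHS]free_ext_letter.
Qed.

Lemma PhiM : {morph Phi phiU phiS : v w / v * w}.
Proof. exact: free_extM. Qed.

Lemma Phi_normal_word (a : semidirect act) : semidirect_set U S act a ->
  Phi phiU phiS (normal_word NU NS a) = a.1 * a.2.
Proof. by move=> [Ua Sa]; rewrite PhiM Phi_wordU Phi_wordS hNU // hNS. Qed.

Lemma Phi_eqv v w : Omega `<=` theta U S act ->
  v ~ w -> Phi phiU phiS v = Phi phiU phiS w.
Proof.
move=> Omega_theta.
apply: (generated_congruence_min (congruence_kernel PhiM) _ (v, w)).
move=> {v w} _ [[[[[p Rp <-]|[p Rp <-]]|[x _ [y _ <-]]]|[x _ <-]]|[p Op <-]];
  rewrite /mkset /fst /snd.
- rewrite !Phi_wordU; case: hphiU => _ _ kerE.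
  have: [set p | phiU p.1 = phiU p.2] p; last by [].
  by rewrite kerE; apply: sub_gen_smallest.
- rewrite !Phi_wordS; case: hphiS => _ _ kerE.
  have: [set p | phiS p.1 = phiS p.2] p; last by [].
  by rewrite kerE; apply: sub_gen_smallest.
- rewrite !PhiM !Phi_wordU !Phi_wordS hNU; last exact: U_act.
  exact: act_commute.
- have U1 : U 1 by apply: hU.1.
  rewrite PhiM Phi_wordU Phi_wordS hNU; last exact: U_act.
  by rewrite -act_commute // mulg1.
- by have [[Mp1 _] [Mp2 _] E] := Omega_theta _ Op; rewrite !Phi_normal_word.
Qed.

End NormalWords.

Theorem theorem6p32 (G : monoidType) (U S : set G) (act : G -> G -> G)
  (XU XS : Type)
  (RU : set (free_monoid XU * free_monoid XU))
  (RS : set (free_monoid XS * free_monoid XS))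
  (phiU : free_monoid XU -> G) (phiS : free_monoid XS -> G)
  (NU : G -> free_monoid XU) (NS : G -> free_monoid XS)
  (Omega : set (semidirect act * semidirect act))
  (hUS : weak_action_pair U S act)
  (hU : submonoid U) (hS : submonoid S)
  (hphiU : has_presentation U RU phiU)
  (hphiS : has_presentation S RS phiS)
  (phiU_neq1 : forall x : XU, phiU (letter x) <> 1)
  (phiS_neq1 : forall x : XS, phiS (letter x) <> 1)
  (phiU_inj : injective (fun x : XU => phiU (letter x)))
  (phiS_inj : injective (fun x : XS => phiS (letter x)))
  (hNU : normal_form_function U phiU NU)
  (hNS : normal_form_function S phiS NS)
  (NU_1 : NU 1 = 1) (NS_1 : NS 1 = 1)
  (NU_letter : forall x : XU, NU (phiU (letter x)) = letter x)
  (NS_letter : forall x : XS, NS (phiS (letter x)) = letter x)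
  (Omega_sub : Omega `<=` Mset U S act `*` Mset U S act)
  (Omega_gen :
     theta U S act = generated_congruence (Mset U S act) Omega) :
  has_presentation (set_mul U S)
    (lift_relU RU `|` lift_relS RS `|` rel1 act phiU phiS NU `|` rel3 act phiS NU
     `|` relOmega NU NS Omega)
    (Phi phiU phiS).
Proof.
have Omega_theta : Omega `<=` theta U S act.
  by rewrite Omega_gen; apply: sub_gen_smallest.
have soundness := Phi_eqv hUS hU hphiU hphiS hNU hNS _ _ Omega_theta.
have reduce :=
  reduce_to_normal (Omega := Omega) hUS hU hS hphiU hphiS hNU hNS NU_1.
split.
- by split; [apply: free_ext1 | apply: free_extM].
- apply/seteqP; split=> [_ [w _ <-]|_ [u Uu [s Ss <-]]].
    have [a [[Ua Sa] _] /soundness ->] := reduce w.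
    rewrite (Phi_normal_word hphiU hphiS hNU hNS) //.
    by exists a.1 => //; exists a.2.
  exists (normal_word NU NS ((u, s) : semidirect act)) => //.
  by rewrite (Phi_normal_word hphiU hphiS hNU hNS).
apply/seteqP; split=> [[v w] /= Evw|[v w]]; last exact: soundness.
have [a Ma va] := reduce v; have [b Mb wb] := reduce w.
have theta_ab : theta U S act (a, b).
  have [[sa _] [sb _]] := (Ma, Mb); split=> //=.
  rewrite -(Phi_normal_word hphiU hphiS hNU hNS a) //.
  rewrite -(Phi_normal_word hphiU hphiS hNU hNS b) //.
  by rewrite -(soundness _ _ va) -(soundness _ _ wb).
have cr := @generated_congruence_full (free_monoid (XU + XS)).
apply: (congruence_trans (cr _)) va _.
apply: (congruence_trans (cr _)) (congruence_sym (cr _) wb).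
exact: (normal_word_theta hUS hU hS hphiU hphiS hNU hNS NU_1).
Qed.
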